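(* Let $M_1,\dots,M_n$ be DFAs over a common alphabet $\Sigma$, and let $G$ and $H$ be the labeled graphs constructed from them as described in the context. Then $\bigcup_{i=1}^n L(M_i)=\Sigma^*$ if and only if $X_H\subseteq X_G$.
   Context: A labeled graph has finite vertex and edge sets, edges with initial/terminal vertices and labels; loops and multiple edges allowed. $X_G$ is the set of bi-infinite label sequences of bi-infinite paths in $G$. A DFA $M_i$ has a finite state set $Q_i$ (the $Q_i$ pairwise disjoint), a total transition function $\delta_i\colon Q_i\times\Sigma\to Q_i$ (viewed as a labeled graph with an edge $q\to\delta_i(q,a)$ labeled $a$), initial state $s_i$ and accepting set $F_i$; $L(M_i)=\{w\in\Sigma^*:\delta_i(s_i,w)\in F_i\}$. Let $\star,\ell,\lhd,\rhd$ be four distinct symbols not in $\Sigma$. $G$: add a vertex $t$ with a self loop labeled $\star$; add a vertex $s^*$ with a self loop labeled $a$ for each $a\in\Sigma\cup\{\ell\}$, and an edge labeled $\rhd$ from $s^*$ to $t$; for each $i$, embed $M_i$ (its states and transition edges), add for each $q\in Q_i$ an edge labeled $\lhd$ from $q$ to $s_i$ and a self loop labeled $\ell$ on $q$, and for each $q\in F_i$ an edge labeled $\rhd$ from $q$ to $t$. $H$: two vertices $q_1,q_2$; at $q_1$ self loops labeled $\lhd$, $\ell$ and each $a\in\Sigma$; an edge labeled $\rhd$ from $q_1$ to $q_2$; a self loop labeled $\star$ at $q_2$. *)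

(* Defs.v *)
From HB Require Import structures.
From mathcomp Require Import all_boot all_order all_algebra.
From mathcomp Require Import classical_sets.

Set Implicit Arguments.
Unset Strict Implicit.
Unset Printing Implicit Defensive.

Local Open Scope classical_set_scope.

Record labeled_graph (A : Type) := LabeledGraph {
  vertex : finType;
  edge : finType;
  src : edge -> vertex;
  tgt : edge -> vertex;
  lab : edge -> A
}.
Arguments src {A} l _.
Arguments tgt {A} l _.
Arguments lab {A} l _.

Definition biinfinite_path (A : Type) (G : labeled_graph A)
    (p : int -> edge G) : Prop :=
  forall k : int, tgt G (p k) = src G (p (k + 1)%R).

Definition shift_of (A : Type) (G : labeled_graph A) : set (int -> A) :=
  [set x | exists2 p : int -> edge G,
      biinfinite_path p & forall k, x k = lab G (p k)].

Record dfa (Sigma : finType) := DFA {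
  state : finType;
  delta : state -> Sigma -> state;
  start : state;
  accept : {set state}
}.
Arguments delta {Sigma} d _ _.
Arguments start {Sigma} d.
Arguments accept {Sigma} d.

Definition language (Sigma : finType) (M : dfa Sigma) : set (seq Sigma) :=
  [set w | foldl (delta M) (start M) w \in accept M].

Inductive symbol (Sigma : Type) :=
  | Letter of Sigma | Star | Ell | Lhd | Rhd.
Arguments Star {Sigma}.
Arguments Ell {Sigma}.
Arguments Lhd {Sigma}.
Arguments Rhd {Sigma}.

Section GraphG.
Context (Sigma : finType) (n : nat) (M : 'I_n -> dfa Sigma).

(* Tagging states with the index of their automaton makes the state sets
   pairwise disjoint. *)
Definition gstate : finType := {i : 'I_n & state (M i)}.

Definition gdelta (q : gstate) (a : Sigma) : gstate :=
  Tagged (fun i => state (M i)) (delta (M (tag q)) (tagged q) a).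

Definition gstart (q : gstate) : gstate :=
  Tagged (fun i => state (M i)) (start (M (tag q))).

Definition gaccept (q : gstate) : bool := tagged q \in accept (M (tag q)).

Inductive gvertex := G_t | G_s | G_state of gstate.

Inductive gedge :=
  | GE_t_star
  | GE_s_letter of Sigma
  | GE_s_ell
  | GE_s_rhd
  | GE_trans of gstate & Sigma
  | GE_lhd of gstate
  | GE_ell of gstate
  | GE_rhd of {q : gstate | gaccept q}.

Definition gvertex_encode (v : gvertex) : option (option gstate) :=
  match v with
  | G_t => None
  | G_s => Some None
  | G_state q => Some (Some q)
  end.

Definition gvertex_decode (c : option (option gstate)) : gvertex :=
  match c with
  | None => G_t
  | Some None => G_s
  | Some (Some q) => G_state q
  end.

Lemma gvertex_encodeK : cancel gvertex_encode gvertex_decode.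
Proof. by case. Qed.

HB.instance Definition _ := Countable.copy gvertex (can_type gvertex_encodeK).
HB.instance Definition _ : isFinite gvertex := CanIsFinite gvertex_encodeK.

Definition gedge_code : finType :=
  ('I_3 + Sigma + gstate * Sigma + gstate + gstate
   + {q : gstate | gaccept q})%type.

Definition gedge_encode (e : gedge) : gedge_code :=
  match e with
  | GE_t_star => inl (inl (inl (inl (inl (inord 0)))))
  | GE_s_ell => inl (inl (inl (inl (inl (inord 1)))))
  | GE_s_rhd => inl (inl (inl (inl (inl (inord 2)))))
  | GE_s_letter a => inl (inl (inl (inl (inr a))))
  | GE_trans q a => inl (inl (inl (inr (q, a))))
  | GE_lhd q => inl (inl (inr q))
  | GE_ell q => inl (inr q)
  | GE_rhd q => inr q
  end.

Definition gedge_decode (c : gedge_code) : gedge :=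
  match c with
  | inl (inl (inl (inl (inl k)))) =>
      if val k == 0 then GE_t_star
      else if val k == 1 then GE_s_ell else GE_s_rhd
  | inl (inl (inl (inl (inr a)))) => GE_s_letter a
  | inl (inl (inl (inr (q, a)))) => GE_trans q a
  | inl (inl (inr q)) => GE_lhd q
  | inl (inr q) => GE_ell q
  | inr q => GE_rhd q
  end.

Lemma gedge_encodeK : cancel gedge_encode gedge_decode.
Proof. by case=> //=; rewrite inordK. Qed.

HB.instance Definition _ := Countable.copy gedge (can_type gedge_encodeK).
HB.instance Definition _ : isFinite gedge := CanIsFinite gedge_encodeK.

Definition gsrc (e : gedge) : gvertex :=
  match e with
  | GE_t_star => G_t
  | GE_s_letter _ | GE_s_ell | GE_s_rhd => G_s
  | GE_trans q _ | GE_lhd q | GE_ell q => G_state q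
  | GE_rhd q => G_state (val q)
  end.

Definition gtgt (e : gedge) : gvertex :=
  match e with
  | GE_t_star | GE_s_rhd | GE_rhd _ => G_t
  | GE_s_letter _ | GE_s_ell => G_s
  | GE_trans q a => G_state (gdelta q a)
  | GE_lhd q => G_state (gstart q)
  | GE_ell q => G_state q
  end.

Definition glab (e : gedge) : symbol Sigma :=
  match e with
  | GE_t_star => Star
  | GE_s_letter a | GE_trans _ a => Letter a
  | GE_s_ell | GE_ell _ => Ell
  | GE_s_rhd | GE_rhd _ => Rhd
  | GE_lhd _ => Lhd
  end.

Definition graphG : labeled_graph (symbol Sigma) :=
  @LabeledGraph (symbol Sigma) gvertex gedge gsrc gtgt glab.

End GraphG.

Inductive hvertex := H_q1 | H_q2.

Definition hvertex_encode (v : hvertex) : bool :=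
  if v is H_q1 then true else false.

Definition hvertex_decode (b : bool) : hvertex := if b then H_q1 else H_q2.

Lemma hvertex_encodeK : cancel hvertex_encode hvertex_decode.
Proof. by case. Qed.

HB.instance Definition _ := Countable.copy hvertex (can_type hvertex_encodeK).
HB.instance Definition _ : isFinite hvertex := CanIsFinite hvertex_encodeK.

Section GraphH.
Context (Sigma : finType).

Inductive hedge :=
  | HE_letter of Sigma | HE_lhd | HE_ell | HE_rhd | HE_star.

Definition hedge_encode (e : hedge) : Sigma + 'I_4 :=
  match e with
  | HE_letter a => inl a
  | HE_lhd => inr (inord 0)
  | HE_ell => inr (inord 1)
  | HE_rhd => inr (inord 2)
  | HE_star => inr (inord 3)
  end.

Definition hedge_decode (c : Sigma + 'I_4) : hedge :=
  match c with
  | inl a => HE_letter a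
  | inr k => nth HE_star [:: HE_lhd; HE_ell; HE_rhd; HE_star] k
  end.

Lemma hedge_encodeK : cancel hedge_encode hedge_decode.
Proof. by case=> //=; rewrite inordK. Qed.

HB.instance Definition _ := Countable.copy hedge (can_type hedge_encodeK).
HB.instance Definition _ : isFinite hedge := CanIsFinite hedge_encodeK.

Definition hsrc (e : hedge) : hvertex :=
  match e with
  | HE_letter _ | HE_lhd | HE_ell | HE_rhd => H_q1
  | HE_star => H_q2
  end.

Definition htgt (e : hedge) : hvertex :=
  match e with
  | HE_letter _ | HE_lhd | HE_ell => H_q1
  | HE_rhd | HE_star => H_q2
  end.

Definition hlab (e : hedge) : symbol Sigma :=
  match e with
  | HE_letter a => Letter a
  | HE_lhd => Lhd
  | HE_ell => Ell
  | HE_rhd => Rhd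
  | HE_star => Star
  end.

Definition graphH : labeled_graph (symbol Sigma) :=
  @LabeledGraph (symbol Sigma) hvertex hedge hsrc htgt hlab.

End GraphH.

(* Main.v *)
(**
  A word [w] outside the union gives the point [... ell ell lhd w rhd star ...]
  of X_H, and reading it in G forces the automaton entered by [lhd] to accept
  [w]. Conversely, a point of X_H without [lhd] is read in G through [s^*] and
  [t]. If it contains [lhd], the word between the last [lhd] and [rhd] (if
  any) chooses an automaton M_i; since all symbols act on the finite state set
  of M_i by total maps, compactness gives a bi-infinite run of M_i, and [lhd]
  makes this run independent of its past, so it accepts at [rhd].
*)
Require Import Defs.
From mathcomp Require Import all_boot all_order all_algebra.
From mathcomp Require Import classical_sets.
From mathcomp Require Import boolp filter.
From mathcomp Require Import zify.

Set Implicit Arguments.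
Unset Strict Implicit.
Unset Printing Implicit Defensive.

Import Order.TTheory GRing.Theory Num.Theory.
Local Open Scope classical_set_scope.

(** If no fiber of [g] were in [U], all their complements would be, and so would the finite
    intersection of these, which is empty. *)
Lemma ultra_finite_cover (T : Type) (Q : finType) (U : set_system T)
    (UU : UltraFilter U) (g : T -> Q) : exists s, U [set t | g t = s].
Proof.
apply: contrapT => noU.
have : U [set t | forall s, g t <> s].
  apply: filter_forall => s.
  by case: (in_ultra_setVsetC [set t | g t = s] UU) => // Us; case: noU; exists s.
by move=> /filter_ex [t /(_ (g t))]; apply.
Qed.

(* The run is the ultrafilter limit, as N grows, of the runs started in [q0]
   at time -N. *)
Lemma biinfinite_run (Q : finType) (q0 : Q) (f : int -> Q -> Q) :
  exists q : int -> Q, forall k, q (k + 1)%R = f k (q k).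
Proof.
pose run (N : nat) := fix run m :=
  if m is m'.+1 then f (m'%:Z - N%:Z)%R (run m') else q0.
(* State at time [k] of the run started at time [-N]. The absolute value gives junk when [k < -N],
   hence the restriction to large [N] below. *)
pose r (k : int) N := run N `|(k + N%:Z)%R|%N.
have rS k N : (`|k| <= N)%N -> r (k + 1)%R N = f k (r k N).
  move=> kN; rewrite /r.
  have -> : `|(k + 1 + N%:Z)%R|%N = `|(k + N%:Z)%R|%N.+1 by lia.
  by move=> /=; congr f; lia.
have [U [UU evU]] := ultraFilterLemma eventually_filter.
have [q qP] := choice (fun k => @ultra_finite_cover _ Q U UU (r k)).
exists q => k.
have big : U [set N | (`|k| <= N)%N] by apply: evU; exists `|k|%N.
(* A single [N] realizes the limit states at both [k] and [k + 1], so the limit inherits the step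
   relation. *)
have /filter_ex[N [kN [/= <- <-]]] :
    U ([set N | (`|k| <= N)%N] `&` ([set N | r (k + 1)%R N = q (k + 1)%R]
       `&` [set N | r k N = q k])) by do 2?[apply: filterI].
exact: rS.
Qed.

(** Lets a path be given by its vertices alone; choice then selects the edges. *)
Lemma shift_ofE (A : Type) (G : labeled_graph A) (x : int -> A) :
  shift_of G x <-> exists v : int -> vertex G, forall k, exists e,
    [/\ src G e = v k, tgt G e = v (k + 1)%R & x k = lab G e].
Proof.
split=> [[p pP xE]|[v /choice[p pP]]].
  by exists (fun k => src G (p k)) => k; exists (p k).
exists p => k; last by have [] := pP k.
by have [_ -> _] := pP k; have [-> _ _] := pP (k + 1)%R.
Qed.

Section Reduction.
Context (Sigma : finType) (n : nat) (M : 'I_n -> dfa Sigma).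

(** [Lhd] sits at position 0 and [Rhd] at [size w + 1]; the default value of [nth] supplies the
    infinite tail of [Star]. *)
Definition marked_word (w : seq Sigma) (k : int) : symbol Sigma :=
  match k with
  | Negz _ => Ell
  | Posz m => nth Star (Lhd :: rcons (map (@Letter Sigma) w) Rhd) m
  end.

Lemma marked_word_in_H (w : seq Sigma) : shift_of (graphH Sigma) (marked_word w).
Proof.
apply/shift_ofE.
exists (fun k : int => if (k <= (size w).+1%:Z)%R then H_q1 else H_q2).
case=> [[|m]|m] /=.
- by exists (HE_lhd _); split=> //=.
- rewrite nth_rcons size_map.
  case: ltngtP => [mw|wm|->].
  + have [a aE] : exists a, nth Star [seq Letter i | i <- w] m = Letter a.
      case: w mw => // b w mw; exists (nth b (b :: w) m).
      by rewrite (nth_map b).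
    exists (HE_letter a); split=> //=; case: ifP => //; lia.
  + exists (HE_star _); split=> //=; case: ifP => //; lia.
  + exists (HE_rhd _); split=> //=; case: ifP => //; lia.
- by exists (HE_ell _); split=> //=; case: ifP => //; lia.
Qed.

(** From an embedded state, a letter forces the transition edge, and [Rhd] labels an edge only if
    the state is accepting. *)
Lemma accept_of_path (p : int -> edge (graphG M)) (w : seq Sigma) :
  biinfinite_path p -> forall (k : int) (q : gstate M),
  src (graphG M) (p k) = G_state q ->
  (forall m, (m <= size w)%N -> lab (graphG M) (p (k + m%:Z)%R) =
     nth Star (rcons (map (@Letter Sigma) w) Rhd) m) ->
  foldl (delta (M (tag q))) (tagged q) w \in accept (M (tag q)).
Proof.
move=> pP; elim: w => [|a w IHw] k q /= srcq labE.
  have := labE 0%N isT; rewrite addr0 /= => {labE}.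
  case: (p k) srcq => //= -[q' acc] /= [<-] _; exact: acc.
have := labE 0%N isT; rewrite addr0 /=.
have := pP k; case: (p k) srcq => //= q' b [->] srcS [ab]; subst b.
apply: (IHw (k + 1)%R (gdelta q a)); first exact/esym/srcS.
by move=> m mw; have := labE m.+1 mw; rewrite intS addrA.
Qed.

Lemma marked_word_accepted (w : seq Sigma) :
  shift_of (graphG M) (marked_word w) -> exists i, language (M i) w.
Proof.
case=> p pP xE.
(* Only edges [GE_lhd q] carry [Lhd], so at time 1 the path is at the initial state of some
   automaton. *)
have := xE 0%R; have := pP 0%R; case: (p 0%R) => //= q srcS _.
exists (tag q).
apply: (@accept_of_path p w pP 1%R (gstart q)); first exact/esym/srcS.
by move=> m _; rewrite -xE -PoszD add1n.
Qed.

(** [Star] and [Rhd] act as the identity to keep every step total, as [biinfinite_run] requires. *)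
Definition dfa_step (D : dfa Sigma) (c : symbol Sigma) (q : state D) : state D :=
  match c with
  | Letter a => delta D q a
  | Lhd => start D
  | _ => q
  end.
Arguments dfa_step : clear implicits.

Definition word_step (w : seq Sigma) (c : symbol Sigma) : seq Sigma :=
  match c with
  | Letter a => rcons w a
  | Lhd => [::]
  | _ => w
  end.

(* The word read since the last [Lhd], for a reading that begins at [k] just
   after some [Lhd]. *)
Fixpoint pending_word (x : int -> symbol Sigma) (k : int) (m : nat) : seq Sigma :=
  if m is m'.+1 then word_step (pending_word x k m') (x (k + m'%:Z)%R) else [::].

(** The [Lhd] at [j] erases the past of the run; afterwards [word_step] mirrors [dfa_step], later
    resets included. *)
Lemma run_pending_word (D : dfa Sigma) (x : int -> symbol Sigma)
    (q : int -> state D) (j : int) :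
  (forall k, q (k + 1)%R = dfa_step D (x k) (q k)) -> x j = Lhd ->
  forall m : nat, q (j + 1 + m%:Z)%R =
    foldl (delta D) (start D) (pending_word x (j + 1)%R m).
Proof.
move=> qS xj; elim=> [|m IHm]; first by rewrite addr0 qS xj.
rewrite -addn1 PoszD addrA qS addn1 /= IHm.
by case: (x _) => //= a; rewrite foldl_rcons.
Qed.

Lemma H_stays_q2 (p : int -> edge (graphH Sigma)) (k l : int) :
  biinfinite_path p -> tgt (graphH Sigma) (p k) = H_q2 -> (k < l)%R ->
  src (graphH Sigma) (p l) = H_q2.
Proof.
move=> pP tk kl.
have -> : l = (k + 1 + `|(l - k - 1)%R|%N%:Z)%R by lia.
elim: `|_|%N => [|m IHm]; first by rewrite addr0 -pP.
rewrite -addn1 PoszD addrA -pP.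
by case: (p _) IHm.
Qed.

(** An [Rhd] edge leaves [H_q1] for [H_q2], from which there is no return. *)
Lemma H_rhd_unique (p : int -> edge (graphH Sigma)) (k l : int) :
  biinfinite_path p -> p k = HE_rhd _ -> p l = HE_rhd _ -> k = l.
Proof.
move=> pP.
wlog kl : k l / (k <= l)%R.
  by move=> wl pk pl; case: (lerP k l) => [|/ltW] kl; [|symmetry]; apply: wl.
move=> pk pl; move: kl; rewrite le_eqVlt => /orP[/eqP //|kl].
by have := H_stays_q2 pP _ kl; rewrite pk pl => /(_ erefl).
Qed.

Lemma H_avoiding_lhd_in_G (p : int -> edge (graphH Sigma)) :
  biinfinite_path p -> (forall k, p k <> HE_lhd _) ->
  shift_of (graphG M) (fun k => lab (graphH Sigma) (p k)).
Proof.
move=> pP nolhd; apply/shift_ofE.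
exists (fun k => if src (graphH Sigma) (p k) is H_q1 then G_s M else G_t M) => k.
rewrite -pP; have := nolhd k; case: (p k) => [a|//|||] _.
- by exists (GE_s_letter M a).
- by exists (GE_s_ell M).
- by exists (GE_s_rhd M).
- by exists (GE_t_star M).
Qed.

Lemma H_accepting_run_in_G (p : int -> edge (graphH Sigma)) (i : 'I_n)
    (q : int -> state (M i)) :
  biinfinite_path p ->
  (forall k, q (k + 1)%R = dfa_step (M i) (lab (graphH Sigma) (p k)) (q k)) ->
  (forall k, p k = HE_rhd _ -> q k \in accept (M i)) ->
  shift_of (graphG M) (fun k => lab (graphH Sigma) (p k)).
Proof.
move=> pP qS qacc; apply/shift_ofE.
pose s k : gstate M := Tagged (fun i => state (M i)) (q k).
exists (fun k => if src (graphH Sigma) (p k) is H_q1 then G_state (s k) else G_t M).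
move=> k; rewrite -pP /s qS; have := qacc k; case: (p k) => [a||||] acc.
- by exists (GE_trans (s k) a).
- by exists (GE_lhd (s k)).
- by exists (GE_ell (s k)).
- by exists (GE_rhd (exist (@gaccept _ _ M) (s k) (acc erefl))).
- by exists (GE_t_star M).
Qed.

Lemma H_sub_G : (forall w, exists i, language (M i) w) ->
  shift_of (graphH Sigma) `<=` shift_of (graphG M).
Proof.
move=> univ x [p pP xE].
have {x xE} -> : x = fun k => lab (graphH Sigma) (p k) by apply/funext.
have [[j pj]|nolhd] := pselect (exists j, p j = HE_lhd _); last first.
  by apply: H_avoiding_lhd_in_G => // k pk; apply: nolhd; exists k.
set x := fun k => _.
have xj : x j = Lhd by rewrite /x pj.
(* The position [j] need not be that of the last [Lhd], since [pending_word] restarts at each one.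
   Without [Rhd] any [w] would do. *)
have [w wP] : exists w, forall k, p k = HE_rhd _ ->
    exists2 m : nat, k = (j + 1 + m%:Z)%R & pending_word x (j + 1)%R m = w.
  have [[k pk]|norhd] := pselect (exists k, p k = HE_rhd _); last first.
    by exists [::] => k pk; case: norhd; exists k.
  exists (pending_word x (j + 1)%R `|(k - j - 1)%R|%N) => l pl.
  rewrite (H_rhd_unique pP pl pk); exists `|(k - j - 1)%R|%N => //.
  (* After [Rhd] the path stays at [H_q2], where no [Lhd] edge starts. *)
  have jk : (j < k)%R.
    case: (ltgtP j k) => // [kj|jk]; last by move: pj; rewrite jk pk.
    by have := H_stays_q2 pP _ kj; rewrite pk pj => /(_ erefl).
  lia.
have [i wi] := univ w.
have [q qS] := biinfinite_run (start (M i)) (fun k => dfa_step (M i) (x k)).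
apply: (@H_accepting_run_in_G p i q) => // k /wP[m -> wE].
by rewrite (run_pending_word qS xj) wE.
Qed.

End Reduction.

Theorem theorem4p13 (Sigma : finType) (n : nat) (M : 'I_n -> dfa Sigma) :
  \bigcup_(i in [set: 'I_n]) language (M i) = [set: seq Sigma] <->
  shift_of (graphH Sigma) `<=` shift_of (graphG M).
Proof.
split=> [univ|HG].
  apply: H_sub_G => w.
  have : [set: seq Sigma] w by [].
  by rewrite -univ => -[i _ wi]; exists i.
apply/seteqP; split=> // w _.
have [i wi] := marked_word_accepted (HG _ (marked_word_in_H w)).
by exists i.
Qed.
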